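(* Let $X$ be an infinite-dimensional separable Banach space of analytic functions on $\mathbb{D}$ such that: (1) $H^\infty$ is dense in $X$ (in particular $H^\infty\subset X$); and (2) for every analytic self-map $\psi:\mathbb{D}\to\mathbb{D}$ and every $u\in H^\infty$, the weighted composition operator $C_{u,\psi}$ is a bounded operator on $X$ and $\|(C_{u,\psi})^n f\|_X\le \|u^{(n)}\|_X\,\|f\|_\infty$ for all $f\in H^\infty$ and all $n\in\mathbb{N}$. Let $\varphi:\mathbb{D}\to\mathbb{D}$ be an analytic self-map and $w\in H^\infty$. Then $C_{w,\varphi}$ is densely Li--Yorke chaotic on $X$ if there is an increasing sequence $(n_k)_{k\in\mathbb{N}}$ of positive integers such that (i) $\lim_{k\to\infty}\|w^{(n_k)}\|_X=0$, and (ii) $\sup\{\|w^{(n)}\|_X:n\in\mathbb{N}\}=\infty$.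
   Context: $\mathbb{D}$ is the open unit disk in $\mathbb{C}$, $\mathbb{N}=\{1,2,\dots\}$. $H^\infty$ is the space of bounded analytic functions on $\mathbb{D}$ with $\|f\|_\infty=\sup_{z\in\mathbb{D}}|f(z)|$. For an analytic self-map $\varphi$ of $\mathbb{D}$ and $w\in H^\infty$, the weighted composition operator is $C_{w,\varphi}f=w\cdot(f\circ\varphi)$; $\varphi^n$ denotes the $n$-fold iterate of $\varphi$; and $w^{(1)}=w$, $w^{(n)}=(w\circ\varphi^{n-1})\cdots(w\circ\varphi)\cdot w$ for $n\ge2$ (so $w^{(n)}$ depends on $\varphi$ too; $u^{(n)}$ is formed with $\psi$ in the same way), so that $(C_{w,\varphi})^nf=w^{(n)}\cdot(f\circ\varphi^n)$. A bounded operator $T$ on a Banach space $X$ is densely Li--Yorke chaotic if there is an uncountable dense set $S\subset X$ such that for all distinct $x,y\in S$, $\liminf_{n\to\infty}\|T^nx-T^ny\|=0$ and $\limsup_{n\to\infty}\|T^nx-T^ny\|>0$. *)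

(* Defs.v *)
From HB Require Import structures.
From mathcomp Require Import all_boot all_order all_algebra.
From mathcomp Require Import all_classical all_reals all_analysis.
From mathcomp Require Import complex.

Set Implicit Arguments.
Unset Strict Implicit.
Unset Printing Implicit Defensive.

Import Order.TTheory GRing.Theory Num.Theory.
Import numFieldNormedType.Exports.

Local Open Scope classical_set_scope.
Local Open Scope ring_scope.

(* The complex field is R[i]; its regular module R[i]^o carries the topology,  *)
(* so that [derivable f z 1] for f : R[i]^o -> R[i]^o is complex               *)
(* differentiability at z.                                                     *)
Notation Cplx R := (R[i]^o)%type.

(* Norms over R[i] are R[i]-valued (with zero imaginary part). *)
Definition rnorm (R : realType) (V : normedModType R[i]) (x : V) : R :=
  complex.Re `|x|.

Definition disk (R : realType) : set (Cplx R) := [set z | `|z| < 1].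

(* A function on the disk is represented by a total function; its values       *)
(* outside the disk are irrelevant in all the definitions below.               *)
Definition eq_disk (R : realType) (f g : Cplx R -> Cplx R) : Prop :=
  forall z, disk z -> f z = g z.

Definition analytic (R : realType) (f : Cplx R -> Cplx R) : Prop :=
  forall z, disk z -> derivable f z 1.

Definition self_map (R : realType) (phi : Cplx R -> Cplx R) : Prop :=
  analytic phi /\ (forall z, disk z -> disk (phi z)).

Definition Hinfty (R : realType) : set (Cplx R -> Cplx R) :=
  [set f | analytic f /\ exists M : R, forall z, disk z -> rnorm (f z) <= M].

Definition supnorm (R : realType) (f : Cplx R -> Cplx R) : R :=
  sup [set rnorm (f z) | z in @disk R].

Definition wcomp (R : realType) (w phi f : Cplx R -> Cplx R) :
    Cplx R -> Cplx R :=
  fun z => w z * f (phi z).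

Definition wprod (R : realType) (w phi : Cplx R -> Cplx R) (n : nat) :
    Cplx R -> Cplx R :=
  fun z => \prod_(0 <= i < n) w (iter i phi z).

(* X is (via iota) a vector space of analytic functions on the disk, with the  *)
(* pointwise operations.  No continuity of point evaluations is required.      *)
Definition analytic_function_space (R : realType) (X : normedModType R[i])
    (iota : X -> Cplx R -> Cplx R) : Prop :=
  [/\ forall (a : R[i]) (x y : X),
        eq_disk (iota (a *: x + y)) (fun z => a * iota x z + iota y z),
      forall x y : X, eq_disk (iota x) (iota y) -> x = y
    & forall x : X, analytic (iota x)].

Definition in_space (R : realType) (X : normedModType R[i])
    (iota : X -> Cplx R -> Cplx R) (f : Cplx R -> Cplx R) : Prop :=
  exists x : X, eq_disk (iota x) f.

(* The element of X that is the function f; the default 0 is only reached when *)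
(* f is not in the space.                                                      *)
Definition elt (R : realType) (X : normedModType R[i])
    (iota : X -> Cplx R -> Cplx R) (f : Cplx R -> Cplx R) : X :=
  xget 0 [set x : X | eq_disk (iota x) f].

Definition fnorm (R : realType) (X : normedModType R[i])
    (iota : X -> Cplx R -> Cplx R) (f : Cplx R -> Cplx R) : R :=
  rnorm (elt iota f).

Definition wcomp_op (R : realType) (X : normedModType R[i])
    (iota : X -> Cplx R -> Cplx R) (w phi : Cplx R -> Cplx R) : X -> X :=
  fun x => elt iota (wcomp w phi (iota x)).

Definition bounded_operator (R : realType) (X : normedModType R[i])
    (T : X -> X) : Prop :=
  linear T /\ exists M : R, forall x : X, rnorm (T x) <= M * rnorm x.

Definition infinite_dimensional (R : realType) (X : normedModType R[i]) :
    Prop :=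
  ~ exists s : seq X, forall x : X, exists c : nat -> R[i],
      x = \sum_(i < size s) c i *: s`_i.

Definition separable_space (X : topologicalType) : Prop :=
  exists S : set X, countable S /\ dense S.

Definition densely_Li_Yorke_chaotic (R : realType) (X : normedModType R[i])
    (T : X -> X) : Prop :=
  exists S : set X,
    [/\ ~ countable S, dense S
      & forall x y : X, S x -> S y -> x <> y ->
          limn_einf (fun n => (rnorm (iter n T x - iter n T y))%:E) = 0%E /\
          (0 < limn_esup (fun n => (rnorm (iter n T x - iter n T y))%:E))%E].

(* Main.v *)
Require Import Defs.
From HB Require Import structures.
From mathcomp Require Import all_boot all_order all_algebra.
From mathcomp Require Import all_classical all_reals all_analysis.
From mathcomp Require Import complex.

Set Implicit Arguments.
Unset Strict Implicit.
Unset Printing Implicit Defensive.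

Import Order.TTheory GRing.Theory Num.Theory.
Import numFieldNormedType.Exports.
Local Open Scope classical_set_scope.
Local Open Scope ring_scope.

(* Write T for the operator, e for the constant function 1, X0 for the bounded *)
(* functions of X and N for the vectors whose T-orbit tends to 0.  By the norm *)
(* hypothesis and (i), every x in X0 satisfies T^{n_k} x --> 0, so two points  *)
(* of X0 form a Li-Yorke pair as soon as they are incongruent modulo N.  Since *)
(* T^n e = w^{(n)}, (ii) says that e is not in N, hence for given x at most    *)
(* one scalar t satisfies x + t e in N.  One can therefore perturb a dense     *)
(* sequence of X0 by small multiples of e into a sequence (v_n) that is        *)
(* pairwise incongruent modulo N, and then add all real multiples of e but     *)
(* countably many (at most one is congruent to each v_n).                      *)

(** The function theory enters through [iota_iter_wcomp_op], which turns orbits into products with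
    [wprod]. The rest is linear: [dense_uncountable_transversal] finds an uncountable dense part of
    X0 whose points are pairwise incongruent modulo N, the engine being [translate_uniq], and
    [Li_Yorke_chaotic_of_subseq] reads incongruence as a Li-Yorke pair. *)

Lemma normr_rnorm (R : realType) (V : normedModType R[i]) (x : V) :
  `|x| = (rnorm x)%:C%C.
Proof. by rewrite RRe_real // realE normr_ge0. Qed.

Lemma rnorm_ge0 (R : realType) (V : normedModType R[i]) (x : V) : 0 <= rnorm x.
Proof. by rewrite -lecR -normr_rnorm normr_ge0. Qed.

Lemma rnormD (R : realType) (V : normedModType R[i]) (x y : V) :
  rnorm (x + y) <= rnorm x + rnorm y.
Proof. by rewrite -lecR rmorphD /= -!normr_rnorm ler_normD. Qed.

Lemma rnormZ (R : realType) (V : normedModType R[i]) (a : R[i]) (x : V) :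
  rnorm (a *: x) = rnorm (a : Cplx R) * rnorm x.
Proof.
by apply: complexI; rewrite rmorphM /= -!normr_rnorm normrZ.
Qed.

Lemma rnorm_real (R : realType) (t : R) : rnorm (t%:C%C : Cplx R) = `|t|.
Proof. by rewrite /rnorm normc_def /= expr0n addr0 sqrtr_sqr. Qed.

Lemma ball_rnormE (R : realType) (V : normedModType R[i]) (x y : V) (r : R) :
  ball x r%:C%C y = (rnorm (x - y) < r) :> Prop.
Proof. by rewrite -ball_normE /= normr_rnorm ltcR. Qed.

Lemma nbhs_rball (R : realType) (V : normedModType R[i]) (O : set V) (x : V) :
  open O -> O x -> exists2 r : R, 0 < r & forall y, rnorm (x - y) < r -> O y.
Proof.
move=> Oo Ox; have /nbhs_ballP[e e0 eO] := open_nbhs_nbhs (conj Oo Ox).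
(* The radius is a positive element of [R[i]], hence real. *)
have eE : e = (complex.Re e)%:C%C by rewrite RRe_real // realE (ltW e0).
exists (complex.Re e); first by rewrite -ltcR -eE.
by move=> y yr; apply: eO; rewrite eE ball_rnormE.
Qed.

Lemma separable_pi_base (R : realType) (X : normedModType R[i]) :
  separable_space X -> exists B : nat -> set X,
    (forall n, open (B n) /\ B n !=set0) /\
    forall O : set X, open O -> O !=set0 -> exists n, B n `<=` O.
Proof.
move=> [S [/countable_injP[f fI] dS]].
(* A left inverse of the injection [f] on [S], with value 0 off its range. *)
pose c n := xget 0 [set x | S x /\ f x = n].
have cf s : S s -> c (f s) = s.
  move=> Ss; have [Sc fc] : S (c (f s)) /\ f (c (f s)) = f s.
    exact: (@xgetPex X 0 [set x | S x /\ f x = f s] (ex_intro _ s (conj Ss erefl))).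
  by apply: fI => //; rewrite inE.
(* Balls of radius 1/(m+1) about points of [S]; an index that codes no pair gets the whole space, so
   that every [B n] is open and nonempty. *)
pose B n : set X := if @unpickle (nat * nat)%type n is Some p
  then ball (c p.1) (p.2.+1%:R^-1 : R)%:C%C else setT.
exists B; split.
  rewrite /B => n; case: unpickle => [p|]; last first.
    by split; [exact: openT | exists 0].
  split; first exact: ball_open.
  by exists (c p.1); apply: ballxx; rewrite ltcR invr_gt0 ltr0n.
move=> O Oo [x Ox]; have [r r0 rO] := nbhs_rball Oo Ox.
have r20 : 0 < r / 2 by rewrite divr_gt0.
have [|s [xs Ss]] := dS (ball x (r / 2)%:C%C) _ (ball_open _ _).
  by exists x; apply: ballxx; rewrite ltcR.
have [m _ /(_ m (leqnn m)) /= mr] := near_infty_natSinv_lt (PosNum r20).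
exists (pickle (f s, m)) => y; rewrite /B pickleK /= cf // ball_rnormE => sy.
apply: rO; rewrite ball_rnormE in xs.
have -> : x - y = (x - s) + (s - y) by rewrite addrA subrK.
by rewrite (le_lt_trans (rnormD _ _)) // (splitr r) ltrD // (lt_trans sy).
Qed.

(** * Dense uncountable sets incongruent modulo a subspace *)

Section transversal.
Variables (R : realType) (X : normedModType R[i]) (X0 N : set X) (e : X).
Hypothesis X0_lin : forall (a : R[i]) x y, X0 x -> X0 y -> X0 (a *: x + y).
Hypothesis N_lin : forall (a : R[i]) x y, N x -> N y -> N (a *: x + y).
Hypotheses (N0 : N 0) (X0e : X0 e) (Ne : ~ N e).

Let Nopp x : N x -> N (- x).
Proof. by move=> Nx; rewrite -[- x]addr0 -scaleN1r; exact: N_lin. Qed.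

(** Two such parameters would put (s - t) e in [N], and dividing by s - t would put e there. *)
Lemma translate_uniq (x : X) (s t : R) :
  N (x + s%:C%C *: e) -> N (x + t%:C%C *: e) -> s = t.
Proof.
move=> Ns Nt; apply/eqP; rewrite -subr_eq0; apply/negPn/negP => st.
have st' : (s - t)%:C%C != 0 by rewrite -[0]/(0%:C%C) (inj_eq (@complexI _)).
apply: Ne; have := N_lin ((s - t)%:C%C^-1) (N_lin (-1) Nt Ns) N0.
rewrite addr0 scaleN1r opprD addrACA addNr add0r addrC -scalerBl -rmorphB.
by rewrite scalerA mulVf // scale1r.
Qed.

(** Each u in [l] excludes at most one t, so r can be taken below all the finitely many positive
    excluded values. *)
Lemma translate_avoid (x : X) (l : seq X) : exists2 r : R, 0 < r &
  forall t : R, 0 < t < r -> forall u, u \in l -> ~ N (x + t%:C%C *: e - u).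
Proof.
elim: l => [|u l [r r0 rl]]; first by exists 1.
have [[s [s0 Ns]]|nos] :=
    pselect (exists s : R, 0 < s /\ N (x - u + s%:C%C *: e)).
  exists (Num.min r s) => [|t]; first by rewrite lt_min r0.
  rewrite lt_min => /and3P[t0 tr ts] v; rewrite inE => /predU1P[->|vl].
    rewrite addrAC => /(translate_uniq Ns) st.
    by move: ts; rewrite st ltxx.
  by apply: rl vl; rewrite t0.
exists r => // t t0r v; rewrite inE => /predU1P[->|vl]; last exact: rl vl.
by rewrite addrAC => Nt; apply: nos; exists t; case/andP: t0r.
Qed.

Lemma open_avoid (O : set X) (l : seq X) :
  dense X0 -> open O -> O !=set0 ->
  exists v, [/\ O v, X0 v & forall u, u \in l -> ~ N (v - u)].
Proof.
move=> dX0 Oo O0; have [d [Od X0d]] := dX0 _ O0 Oo.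
have [r r0 rO] := nbhs_rball Oo Od.
have [r' r'0 rl] := translate_avoid d l.
have e1 : 0 < rnorm e + 1 by rewrite ltr_wpDl // rnorm_ge0.
(* The first bound keeps d + t e within r of d, the second keeps t below r'; adding 1 to the norm
   makes the estimate strict. *)
pose t := Num.min (r / (rnorm e + 1)) (r' / 2).
have t0 : 0 < t by rewrite lt_min !divr_gt0.
exists (d + t%:C%C *: e); split.
- apply: rO; rewrite opprD addNKr -scaleNr -rmorphN rnormZ rnorm_real normrN.
  rewrite gtr0_norm // (@lt_le_trans _ _ (t * (rnorm e + 1))) //.
    by rewrite ltr_pM2l // ltrDl.
  by rewrite -ler_pdivlMr // ge_min lexx.
- by rewrite addrC; apply: X0_lin.
- apply: rl; rewrite t0 (@le_lt_trans _ _ (r' / 2)) ?ge_min ?lexx ?orbT //.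
  by rewrite ltr_pdivrMr // ltr_pMr // ltr1n.
Qed.

Lemma dense_uncountable_transversal : separable_space X -> dense X0 ->
  exists S : set X, [/\ ~ countable S, dense S, S `<=` X0
    & forall x y, S x -> S y -> x <> y -> ~ N (x - y)].
Proof.
move=> /separable_pi_base[B [Bo Bbase]] dX0.
(* The length of the list of vectors already chosen tells which basic set the next one must meet, so
   that one choice function drives the recursion. *)
have /choice[F FP] : forall l : seq X, exists v,
    [/\ B (size l) v, X0 v & forall u, u \in l -> ~ N (v - u)].
  by move=> l; have [oB nB] := Bo (size l); exact: open_avoid.
pose L n := iter n (fun l => rcons l (F l)) [::].
pose v n := F (L n).
have sL n : size (L n) = n by elim: n => //= n IH; rewrite size_rcons IH.
have vL n m : (n < m)%N -> v n \in L m.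
  elim: m => // m IH; rewrite ltnS leq_eqVlt => /predU1P[->|/IH] /=;
    by rewrite mem_rcons inE ?eqxx // => ->; rewrite orbT.
have vN n m : (n < m)%N -> ~ N (v m - v n).
  by move=> /vL nm; case: (FP (L m)) => _ _; exact.
pose U := [set t : R | forall n, ~ N (t%:C%C *: e - v n)].
pose g (t : R) := t%:C%C *: e.
have gN t s : N (g t - g s) -> t = s.
  move=> Nts; apply: (@translate_uniq (- g s)); first by rewrite addrC.
  by rewrite addNr.
have gI : injective g by move=> t s gts; apply: gN; rewrite gts subrr.
exists (range v `|` g @` U); split.
(* If the set were countable, [U] would be too; together with the exceptional parameters, at most
   one for each [v m], it exhausts the real line, which has positive Lebesgue measure. *)
- move=> /countable_injP[f fI].
  pose G n := if n is m.+1 then [set t : R | N (g t - v m)] else U.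
  have cG n : countable (G n).
    case: n => [|m] /=; apply/countable_injP.
      exists (f \o g) => t s; rewrite !inE => Ut Us /= fgts.
      by apply/gI/fI => //; rewrite inE; right; exact: imageP.
    exists (fun=> 0) => t s; rewrite !inE /= => Nt Ns _.
    by apply: (@translate_uniq (- v m)); rewrite addrC.
  have : countable (\bigcup_n G n).
    by apply: bigcup_countable => [|n _]; [exact: countableP | exact: cG].
  have -> : \bigcup_n G n = [set: R].
    apply/seteqP; split => // t _.
    have [[n Nt]|Ut] := pselect (exists n, N (g t - v n)).
      by exists n.+1.
    by exists 0%N => // n Nt; apply: Ut; exists n.
  move=> /countable_lebesgue_measure0.
  by rewrite -(set_itvNyy R) lebesgue_measure_itv.
- move=> O O0 /(Bbase _)/(_ O0)[n BO]; exists (v n); split; last by left; exists n.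
  by apply: BO; have [Bv _ _] := FP (L n); rewrite sL in Bv.
- move=> _ [[n _ <-]|[t _ <-]]; first by have [] := FP (L n).
  have X00 : X0 0 by rewrite -(addNr e) -scaleN1r; exact: X0_lin.
  by rewrite -[g t]addr0; exact: X0_lin.
- move=> _ _ [[n _ <-]|[t Ut <-]] [[m _ <-]|[s Us <-]].
  + have [/vN mn _ /Nopp|/vN mn _|->//] := ltngtP n m; last by exact: mn.
    by rewrite opprB => /mn.
  + by move=> _ /Nopp; rewrite opprB => /Us.
  + by move=> _ /Ut.
  + by move=> ts /gN tseq; apply: ts; rewrite tseq.
Qed.
End transversal.

(** * From incongruence to Li-Yorke pairs *)

Lemma limn_einf_subseq0 (R : realType) (u : nat -> R) (nk : nat -> nat) :
  (forall n, 0 <= u n) -> (forall i j, (i < j)%N -> (nk i < nk j)%N) ->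
  (fun k => u (nk k)) @ \oo --> (0 : R) ->
  limn_einf (fun n => (u n)%:E) = 0%E.
Proof.
move=> u0 nkS unk; rewrite limn_einf_lim.
have nk_ge k : (k <= nk k)%N.
  by elim: k => // k /leq_ltn_trans; apply; exact: nkS.
(* Every tail infimum is already 0, because each tail contains terms of the null subsequence with
   arbitrarily large index. *)
suff -> : einfs (fun n => (u n)%:E) = cst 0%E by exact: lim_cst.
apply/funext => n; apply/eqP; rewrite eq_le; apply/andP; split; last first.
  by apply: le_ereal_inf_tmp => _ [m _ <-]; rewrite lee_fin.
apply/lee_addgt0Pr => r r0; rewrite add0e.
have [K _ HK] := cvgr_lt _ unk _ r0.
apply: (@le_trans _ _ (u (nk (maxn K n)))%:E).
  apply: ereal_inf_lbound; exists (nk (maxn K n)) => //=.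
  exact: leq_trans (leq_maxr _ _) (nk_ge _).
by rewrite lee_fin ltW //; apply: HK => /=; exact: leq_maxl.
Qed.

(** A nonnegative sequence with limit superior at most 0 converges to 0. *)
Lemma limn_esup_gt0 (R : realType) (u : nat -> R) :
  (forall n, 0 <= u n) -> ~ (u @ \oo --> (0 : R)) ->
  (0 < limn_esup (fun n => (u n)%:E))%E.
Proof.
move=> u0 nu; rewrite ltNge; apply/negP => /limn_esup_le_cvg lu.
by apply/nu/(fine_cvg (lu _)) => n; rewrite lee_fin.
Qed.

Lemma iter_linear (K : pzRingType) (V : lmodType K) (T : V -> V) (n : nat) :
  linear T -> linear (iter n T).
Proof. by move=> Tl a x y; elim: n => //= n ->; rewrite Tl. Qed.

Lemma Li_Yorke_chaotic_of_subseq (R : realType) (X : normedModType R[i])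
    (T : X -> X) (X0 : set X) (nk : nat -> nat) (e : X) :
  linear T -> separable_space X -> dense X0 ->
  (forall (a : R[i]) x y, X0 x -> X0 y -> X0 (a *: x + y)) ->
  (forall i j, (i < j)%N -> (nk i < nk j)%N) ->
  (forall x, X0 x -> (fun k => rnorm (iter (nk k) T x)) @ \oo --> (0 : R)) ->
  X0 e -> ~ ((fun n => rnorm (iter n T e)) @ \oo --> (0 : R)) ->
  densely_Li_Yorke_chaotic T.
Proof.
move=> Tl sepX dX0 X0_lin nkS X0nk X0e eN.
pose N := [set x | (fun n => rnorm (iter n T x)) @ \oo --> (0 : R)].
(* [N] is a subspace, by linearity of the iterates and the triangle inequality. *)
have N_lin (a : R[i]) x y : N x -> N y -> N (a *: x + y).
  move=> Nx Ny.
  have aN : (fun n => rnorm (a : Cplx R) * rnorm (iter n T x)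
      + rnorm (iter n T y)) @ \oo --> (0 : R).
    rewrite -[X in _ --> X]addr0 -[X in _ --> X + _](mulr0 (rnorm (a : Cplx R))).
    by apply: cvgD => //; apply: cvgM => //; exact: cvg_cst.
  apply: (squeeze_cvgr _ (cvg_cst 0) aN); apply: nearW => n.
  by rewrite rnorm_ge0 iter_linear // (le_trans (rnormD _ _)) // rnormZ.
have N0 : N 0.
  suff T0 n : rnorm (iter n T 0) = 0.
    by rewrite /N /=; under eq_fun do rewrite T0; exact: cvg_cst.
  have := iter_linear n Tl (-1) 0 0; rewrite !scaleN1r !addNr => ->.
  by rewrite /rnorm normr0.
have [S [Sc dS SX0 SN]] :=
  dense_uncountable_transversal X0_lin N_lin N0 X0e eN sepX dX0.
exists S; split => // x y Sx Sy xy.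
have TB n : iter n T x - iter n T y = iter n T (x - y).
  have := iter_linear n Tl (-1) y x.
  by rewrite !scaleN1r (addrC (- y)) (addrC (- iter n T y)) => ->.
under eq_fun do rewrite TB; split.
- apply: limn_einf_subseq0 nkS _ => [n|]; first exact: rnorm_ge0.
  by apply: X0nk; rewrite addrC -scaleN1r; apply: X0_lin; exact: SX0.
- by apply: limn_esup_gt0 => [n|]; [exact: rnorm_ge0 | exact: SN].
Qed.

(** * Weighted composition operators *)

Lemma iota_elt (R : realType) (X : normedModType R[i])
    (iota : X -> Cplx R -> Cplx R) (f : Cplx R -> Cplx R) :
  in_space iota f -> eq_disk (iota (elt iota f)) f.
Proof. exact: xgetPex. Qed.

Lemma elt_eq (R : realType) (X : normedModType R[i])
    (iota : X -> Cplx R -> Cplx R) (x : X) (f : Cplx R -> Cplx R) :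
  analytic_function_space iota -> eq_disk (iota x) f -> elt iota f = x.
Proof.
move=> [_ iotaI _] xf; apply: iotaI => z Dz.
by rewrite (iota_elt (ex_intro _ x xf)) ?xf.
Qed.

Lemma iota_iter_wcomp_op (R : realType) (X : normedModType R[i])
    (iota : X -> Cplx R -> Cplx R) (w phi : Cplx R -> Cplx R) (x : X) (n : nat) :
  self_map phi -> (forall y, in_space iota (wcomp w phi (iota y))) ->
  eq_disk (iota (iter n (wcomp_op iota w phi) x))
    (fun z => wprod w phi n z * iota x (iter n phi z)).
Proof.
move=> [_ phiD] wX; elim: n => [|n IH] z Dz /=.
  by rewrite /wprod big_geq // mul1r.
rewrite (iota_elt (wX _)) // /wcomp IH; last exact: phiD.
rewrite -iterSr mulrA; congr (_ * _).
(* The factor of index 0 is split off: w^{(n+1)} = w (w^{(n)} o phi). *)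
rewrite /wprod big_nat_recl //; congr (_ * _).
by apply: eq_bigr => i _; rewrite -iterSr.
Qed.

Lemma Hinfty_linear (R : realType) (X : normedModType R[i])
    (iota : X -> Cplx R -> Cplx R) (a : R[i]) (x y : X) :
  analytic_function_space iota -> Hinfty (iota x) -> Hinfty (iota y) ->
  Hinfty (iota (a *: x + y)).
Proof.
move=> [iota_lin _ iota_an] [_ [Mx xM]] [_ [My yM]]; split; first exact: iota_an.
exists (rnorm (a : Cplx R) * Mx + My) => z Dz.
rewrite iota_lin // (le_trans (rnormD _ _)) // lerD ?yM //.
by rewrite -[a * _]/(a *: (iota x z : Cplx R)) rnormZ ler_wpM2l ?rnorm_ge0 ?xM.
Qed.

Theorem corollary1 (R : realType) (X : completeNormedModType R[i])
  (iota : X -> Cplx R -> Cplx R)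
  (X_fun : analytic_function_space iota)
  (X_infdim : infinite_dimensional X)
  (X_sep : separable_space X)
  (Hinfty_sub : forall f : Cplx R -> Cplx R, Hinfty f -> in_space iota f)
  (Hinfty_dense : dense [set x : X | Hinfty (iota x)])
  (X_wcomp : forall psi u : Cplx R -> Cplx R, self_map psi -> Hinfty u ->
     [/\ forall x : X, in_space iota (wcomp u psi (iota x)),
         bounded_operator (wcomp_op iota u psi)
       & forall (x : X) (n : nat), Hinfty (iota x) -> (0 < n)%N ->
           rnorm (iter n (wcomp_op iota u psi) x)
             <= fnorm iota (wprod u psi n) * supnorm (iota x)])
  (phi w : Cplx R -> Cplx R) (phi_self : self_map phi) (w_Hinfty : Hinfty w)
  (hyp : exists nk : nat -> nat,
     [/\ forall k : nat, (0 < nk k)%N,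
         forall i j : nat, (i < j)%N -> (nk i < nk j)%N,
         (fun k : nat => fnorm iota (wprod w phi (nk k))) @ \oo --> (0 : R)
       & ereal_sup [set (fnorm iota (wprod w phi n))%:E
                    | n in [set n : nat | (0 < n)%N]] = +oo%E]) :
  densely_Li_Yorke_chaotic (wcomp_op iota w phi).
Proof.
have [nk [nk0 nkS nk_cvg w_sup]] := hyp.
have [wX [T_lin _] T_le] := X_wcomp _ _ phi_self w_Hinfty.
have one_Hinfty : Hinfty (fun _ : Cplx R => 1 : Cplx R).
  split; first by move=> z _; exact: derivable_cst.
  by exists (rnorm (1 : Cplx R)).
pose e := elt iota (fun _ => 1).
have eE : eq_disk (iota e) (fun _ => 1) := iota_elt (Hinfty_sub _ one_Hinfty).
have Te n : rnorm (iter n (wcomp_op iota w phi) e) = fnorm iota (wprod w phi n).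
  rewrite /fnorm (elt_eq (x := iter n (wcomp_op iota w phi) e)) // => z Dz.
  rewrite iota_iter_wcomp_op // eE ?mulr1 //.
  by elim: n => //= n; case: phi_self => _; exact.
apply: (@Li_Yorke_chaotic_of_subseq _ _ _ [set x | Hinfty (iota x)] nk e) => //.
- by move=> a x y; exact: Hinfty_linear.
- move=> x Hx; have xN : (fun k => fnorm iota (wprod w phi (nk k))
      * supnorm (iota x)) @ \oo --> (0 : R).
    by rewrite -[X in _ --> X](mul0r (supnorm (iota x))); exact: cvgMl.
  apply: (squeeze_cvgr _ (cvg_cst 0) xN); apply: nearW => k.
  by rewrite rnorm_ge0 T_le.
- split; first by have [_ _ ian] := X_fun; exact: ian.
  by exists (rnorm (1 : Cplx R)) => z /eE ->.
- under eq_fun do rewrite Te.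
  (* A convergent sequence is bounded, against the infinite supremum. Boundedness is stated for
     every constant strictly above [M], hence M + 1 below. *)
  move=> /(cvgP _)/cvg_seq_bounded[M [_ MB]].
  have wM : (ereal_sup [set (fnorm iota (wprod w phi n))%:E
      | n in [set n : nat | (0 < n)%N]] <= (M + 1)%:E)%E.
    apply: ge_ereal_sup => _ [n _ <-]; rewrite lee_fin (le_trans (ler_norm _)) //.
    by apply: MB; rewrite ?ltrDl.
  by rewrite w_sup in wM.
Qed.
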